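(* Let $X$ be a nonempty separable metric space with $\dim X=m$, where $m$ is a nonnegative integer. Then $X$ has a proper dyadic subbase $\mathcal{S}$ with $\deg\mathcal{S}=m$.
   Context: Here $\dim$ is the topological (covering) dimension. A subset of a space is regular open if it equals the interior of its closure; the exterior of a set is the complement of its closure. A dyadic subbase of a space $X$ is a subbase $\mathcal{S}=\{S_{n,i}: n<\omega,\ i<2\}$ of the topology of $X$, indexed by $\omega\times 2$, composed of regular open sets, such that $S_{n,1}$ is the exterior of $S_{n,0}$ for each $n<\omega$. Let $\mathbb{T}=\{0,1,\bot\}$; for $\sigma\in\mathbb{T}^{\omega}$ let $\mathrm{dom}(\sigma)=\{n:\sigma(n)\in\{0,1\}\}$, and let $\mathbb{T}^{*}=\{\sigma\in\mathbb{T}^{\omega}: |\mathrm{dom}(\sigma)|<\infty\}$. For a dyadic subbase $\mathcal{S}$ of $X$ and $\sigma\in\mathbb{T}^{\omega}$, let $S(\sigma)=\bigcap_{k\in\mathrm{dom}(\sigma)}S_{k,\sigma(k)}$ and $\bar{S}(\sigma)=\bigcap_{k\in\mathrm{dom}(\sigma)}\mathrm{cl}\,S_{k,\sigma(k)}$ (an empty intersection is $X$). The dyadic subbase $\mathcal{S}$ is proper if $\mathrm{cl}\,S(\sigma)=\bar{S}(\sigma)$ for every $\sigma\in\mathbb{T}^{*}$. For a dyadic subbase $\mathcal{S}$ of $X$ and $x\in X$, let $\deg_{\mathcal{S}}(x)=|\{n<\omega: x\in X\setminus(S_{n,0}\cup S_{n,1})\}|$, and let $\deg\mathcal{S}=\sup\{\deg_{\mathcal{S}}(x):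 x\in X\}$. *)

(* Defs.v *)
From HB Require Import structures.
From mathcomp Require Import all_boot all_order all_algebra.
From mathcomp Require Import all_classical all_reals all_analysis.

Set Implicit Arguments.
Unset Strict Implicit.
Unset Printing Implicit Defensive.

Import Order.TTheory GRing.Theory Num.Theory.

Local Open Scope classical_set_scope.
Local Open Scope card_scope.
Local Open Scope ring_scope.

Definition separable_space (X : topologicalType) : Prop :=
  exists2 D : set X, countable D & dense D.

Definition finite_open_cover (X : topologicalType) (U : set (set X)) : Prop :=
  [/\ finite_set U, U `<=` open & \bigcup_(A in U) A = setT].

Definition refines (X : Type) (V U : set (set X)) : Prop :=
  forall B, V B -> exists2 A, U A & B `<=` A.

(* dim X < k, that is dim X <= k - 1: every finite open cover has a finite
   open refinement of order at most k - 1, no point lying in more than k of its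
   members. The shift by one makes dim X <= -1 (k = 0) expressible; it holds
   exactly when X is empty. *)
Definition covering_dim_lt (X : topologicalType) (k : nat) : Prop :=
  forall U : set (set X), finite_open_cover U ->
  exists V : set (set X),
    [/\ finite_open_cover V, refines V U &
        forall x : X, ([set B | V B /\ B x] #<= `I_k)].

Definition covering_dim_eq (X : topologicalType) (m : nat) : Prop :=
  covering_dim_lt X m.+1 /\ ~ covering_dim_lt X m.

(* S n i stands for $S_{n,i}$, with false for 0 and true for 1. The empty
   intersection belongs to finI_from. *)
Definition is_subbase (X : topologicalType) (S : nat -> bool -> set X) : Prop :=
  basis (finI_from setT (fun p : nat * bool => S p.1 p.2)).

Definition exterior (X : topologicalType) (A : set X) : set X := ~` closure A.

Definition dyadic_subbase (X : topologicalType) (S : nat -> bool -> set X)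
    : Prop :=
  [/\ is_subbase S, forall n i, regopen (S n i) &
      forall n, S n true = exterior (S n false)].

(* Sequences over {0, 1, bottom} are functions nat -> option bool, with None
   for bottom. *)
Definition tdom (s : nat -> option bool) : set nat := [set n | s n != None].

Definition tinter (X : Type) (S : nat -> bool -> set X)
    (s : nat -> option bool) : set X :=
  \bigcap_(k in tdom s) (if s k is Some i then S k i else setT).

Definition proper_subbase (X : topologicalType) (S : nat -> bool -> set X) : Prop :=
  forall s : nat -> option bool, finite_set (tdom s) ->
    closure (tinter S s) = tinter (fun n i => closure (S n i)) s.

(* Degrees are cardinals in {0, 1, 2, ..., +oo}, seen in the extended reals. *)
Definition deg_at (R : realType) (X : Type) (S : nat -> bool -> set X) (x : X)
    : \bar R :=
  counting [set n | (~` (S n false `|` S n true)) x].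

Definition deg (R : realType) (X : Type) (S : nat -> bool -> set X) : \bar R :=
  ereal_sup [set deg_at R S x | x in [set: X]].

(* Main.v *)
Require Import Defs.
From HB Require Import structures.
From mathcomp Require Import all_boot all_order all_algebra.
From mathcomp Require Import all_classical all_reals all_analysis.
From mathcomp Require Import finmap ring lra.

Set Implicit Arguments.
Unset Strict Implicit.
Unset Printing Implicit Defensive.

Import Order.TTheory GRing.Theory Num.Theory.
Import numFieldNormedType.Exports.

Local Open Scope classical_set_scope.
Local Open Scope card_scope.
Local Open Scope ring_scope.

(** The subbase is S_{n,0} = {g_n < 0}, S_{n,1} = {g_n > 0} for a sequence of
    continuous functions g_n : X -> R in general position. The functions g_n are
    small perturbations of given functions h_n, and a Baire category argument
    ([stably_dense_countable]) yields countably many generic properties at once,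
    as soon as each of them holds on a dense open set of sequences for uniform
    convergence. Two kinds of properties are needed.

    The first one is that for every pattern of signs on finitely many indices and
    every small ball B, either the pattern occurs in B or the corresponding g_n
    have no common zero in B. This is dense because adding small constants of
    the right signs to functions that are almost zero at a point of B creates the
    pattern there ([stably_dense_crossing]). Hence all the sign patterns occur
    near any common zero, so that cl S_{n,0} = {g_n <= 0}, the sets S_{n,i} are
    regular open and exterior to each other, and the subbase is proper.

    The second one is that no m + 1 of the g_n have a common zero, so that the
    degree is at most m. It is dense because dim X <= m: any map X -> R^(m+1) can
    be pushed off 0 by a small perturbation that, up to truncation, factors
    through the nerve of a cover of order m + 1 with its vertices sent to points
    in general position ([dim_lt_unstable_zeros], [general_position]).

    The degree is at least m because of the converse ([unstable_zeros_dim_lt]): if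
    every map X -> R^m could be pushed off 0, then a partition of unity subordinate
    to a finite open cover could be perturbed so that no m + 1 of its functions
    coincide anywhere, and comparing these functions would give a refinement of
    order m, that is dim X < m. So there is a map f : X -> R^m all of whose small
    perturbations have a zero, and it suffices that h_0, ..., h_(m-1) are multiples
    of the components of f. The other h_n, apart from some that are zero, are
    multiples of the distances to points of a countable dense set, minus 1, so
    that the sets {g_n < 0} form a base. *)

(** * Points in general position *)

Lemma small_nonroot (R : realFieldType) (p : {poly R}) (c : R) :
  p != 0 -> 0 < c -> exists2 t, 0 < t < c & ~~ root p (- t).
Proof.
move=> p0 c0.
pose rs := [seq - (c / i.+2%:R) | i <- iota 0 (size p)].
have rs_uniq : uniq rs.
  rewrite map_inj_uniq ?iota_uniq// => i j /oppr_inj/(mulfI (lt0r_neq0 c0)).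
  by move/invr_inj/eqP; rewrite eqr_nat => /eqP[].
have /allPn[/= x /mapP[i _ ->] xp] : ~~ all (root p) rs.
  apply: contraL (leqnn (size p)) => /(max_poly_roots p0)/(_ rs_uniq).
  by rewrite size_map size_iota ltnn.
exists (c / i.+2%:R) => //; rewrite divr_gt0 ?ltr0n//=.
by rewrite ltr_pdivrMr ?ltr0n// ltr_pMr// ltr1n.
Qed.

(** Points of R^k can be moved by as little as wanted to a linearly general
    position: any k of them become independent. The points move along the
    Vandermonde rows u_i = (1, i, i^2, ...). For k indices s, the matrix
    V_s + t U_s is singular only when - t is an eigenvalue of V_s U_s^-1, so
    that finitely many values of t are excluded. *)
Lemma general_position (R : realFieldType) (N k : nat)
    (v : 'I_N -> 'rV[R]_k) (c : R) : 0 < c ->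
  exists w : 'I_N -> 'rV[R]_k, (forall i j, `|w i 0 j - v i 0 j| <= c) /\
    forall s : {ffun 'I_k -> 'I_N}, injective s ->
      row_free (\matrix_(j < k) w (s j)).
Proof.
move=> c0.
pose u (i : 'I_N) : 'rV[R]_k := \row_j (i%:R : R) ^+ j.
pose M := 1 + \sum_i \sum_j `|u i 0 j|.
have M0 : 0 < M.
  by rewrite ltr_pwDl// sumr_ge0// => i _; rewrite sumr_ge0.
have uM i j : `|u i 0 j| <= M.
  rewrite /M (bigD1 i)//= (bigD1 j)//= addrCA -addrA lerDl.
  rewrite addr_ge0 ?sumr_ge0// ler_wpDr// sumr_ge0// => a _.
  by rewrite sumr_ge0.
pose V (s : {ffun 'I_k -> 'I_N}) := \matrix_(j < k) v (s j).
pose U (s : {ffun 'I_k -> 'I_N}) := \matrix_(j < k) u (s j).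
have U_unit (s : {ffun 'I_k -> 'I_N}) : injective s -> U s \in unitmx.
  move=> s_inj; pose a : 'rV[R]_k := \row_j (s j)%:R.
  have -> : U s = (Vandermonde k a)^T by apply/matrixP => i j; rewrite !mxE.
  rewrite unitmx_tr unitmxE det_Vandermonde unitfE.
  apply/prodf_neq0 => i _; apply/prodf_neq0 => j ij.
  rewrite !mxE subr_eq0 eqr_nat; apply: contraTneq ij => sij.
  by rewrite (s_inj j i) ?ltnn//; apply: val_inj.
pose p := \prod_(s : {ffun 'I_k -> 'I_N}) char_poly (V s *m invmx (U s)).
have p0 : p != 0 by apply/prodf_neq0 => s _; rewrite monic_neq0 ?char_poly_monic.
have [t /andP[t0 tc] pt] := small_nonroot p0 (divr_gt0 c0 M0).
exists (fun i => v i + t *: u i); split=> [i j|s s_inj].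
  have -> : (v i + t *: u i) 0 j - v i 0 j = t * u i 0 j.
    by rewrite !mxE addrAC subrr add0r.
  rewrite normrM (gtr0_norm t0).
  apply: le_trans (ler_wpM2l (ltW t0) (uM i j)) _.
  by rewrite -ler_pdivlMr// ltW.
have -> : \matrix_(j < k) (v (s j) + t *: u (s j)) = V s + t *: U s.
  by apply/matrixP => i j; rewrite !mxE.
apply: inj_row_free => x xVU; apply/eqP/negPn/negP => x0.
have /negP := pt; apply; rewrite /root horner_prod.
apply/prodf_eq0; exists s => //.
rewrite -/(root _ _) -eigenvalue_root_char; apply/eigenvalueP; exists x => //.
have/eqP := xVU; rewrite mulmxDr addr_eq0 -scalemxAr => /eqP xV.
by rewrite mulmxA xV scaleNr mulNmx -scalemxAl mulmxK// U_unit.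
Qed.

(** * Finite cardinals *)

(** A set of at most k indices is contained in the range of k distinct ones. *)
Lemma enum_set_into (N k : nat) (A : {set 'I_N}) : (#|A| <= k <= N)%N ->
  exists s : {ffun 'I_k -> 'I_N}, injective s /\
    forall i, i \in A -> exists j, s j = i.
Proof.
move=> /andP[Ak kN].
pose l := enum A ++ enum (~: A)%SET.
have size_l : size l == N.
  by rewrite size_cat -!cardE cardsC card_ord.
have l_uniq : uniq l.
  rewrite cat_uniq !enum_uniq andbT/=; apply/hasPn => i.
  by rewrite !mem_enum finset.in_setC.
exists [ffun j => tnth (Tuple size_l) (widen_ord kN j)]; split=> [i j|i iA].
  rewrite !ffunE => /(tuple_uniqP (Tuple size_l) l_uniq) /(congr1 val) /= ij.
  exact: val_inj.
have iE : i \in enum A by rewrite mem_enum.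
have ik : (index i l < k)%N.
  by rewrite index_cat iE (leq_trans _ Ak)// cardE index_mem.
exists (Ordinal ik); rewrite ffunE (tnth_nth i) /= nth_index//.
by rewrite mem_cat iE.
Qed.

Lemma card_eq_seq (T : choiceType) (s : seq T) :
  uniq s -> [set` s] #= `I_(size s).
Proof.
move=> s_uniq.
have -> : [set` s] = [set` [fset x in s]%fset].
  by apply/seteqP; split=> x /=; rewrite in_fset.
by apply/card_eq_fsetP; rewrite card_fseq undup_id.
Qed.

Lemma card_le_ord_set (T : finType) (k : nat) (A : {set T}) :
  ([set` A] #<= `I_k) = (#|A| <= k)%N.
Proof.
have -> : [set` A] = [set` enum A].
  by apply/seteqP; split=> x /=; rewrite mem_enum.
by rewrite cardE -card_le_II; apply/card_le_eql/card_eq_seq/enum_uniq.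
Qed.

Lemma counting_le (R : realType) (T : choiceType) (A : set T) (m : nat) :
  (forall B : {fset T}, [set` B] `<=` A -> (#|` B| <= m)%N) ->
  (counting A <= m%:R%:E :> \bar R)%E.
Proof.
move=> Am; rewrite /counting; case: asboolP => [Afin|/(infinite_set_fset m.+1)].
  by rewrite lee_fin ler_nat; apply: Am; rewrite fset_setK.
by move=> [B /Am Bm mB]; have := leq_trans mB Bm; rewrite ltnn.
Qed.

Lemma counting_ge (R : realType) (A : set nat) (m : nat) :
  `I_m `<=` A -> (m%:R%:E <= counting A :> \bar R)%E.
Proof.
move=> mA; rewrite /counting; case: asboolP => [Afin|_]; last exact: leey.
rewrite lee_fin ler_nat leq_card_fset_set//; exact: subset_card_le.
Qed.

(** * Generic sequences of continuous functions *)

Section RealFunctions.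
Context {R : realType} {X : topologicalType}.
Implicit Types u v : X -> R.

Lemma continuous_fct_add u v :
  continuous u -> continuous v -> continuous (fun x => u x + v x).
Proof. by move=> uc vc x; apply: cvgD; [exact: uc|exact: vc]. Qed.

Lemma continuous_fct_sub u v :
  continuous u -> continuous v -> continuous (fun x => u x - v x).
Proof. by move=> uc vc x; apply: cvgB; [exact: uc|exact: vc]. Qed.

Lemma continuous_fct_mul u v :
  continuous u -> continuous v -> continuous (fun x => u x * v x).
Proof. by move=> uc vc x; apply: cvgM; [exact: uc|exact: vc]. Qed.

Lemma continuous_fct_cst (a : R) : continuous (fun _ : X => a).
Proof. by move=> x; exact: cvg_cst. Qed.

Lemma continuous_fct_norm u : continuous u -> continuous (fun x => `|u x|).
Proof. by move=> uc x; apply: cvg_norm; exact: uc. Qed.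

Lemma continuous_fct_inv u :
  continuous u -> (forall x, u x != 0) -> continuous (fun x => (u x)^-1).
Proof. by move=> uc u0 x; apply: cvgV; [exact: u0|exact: uc]. Qed.

Lemma continuous_fct_max (u v : X -> R) :
  continuous u -> continuous v -> continuous (fun x => Num.max (u x) (v x)).
Proof. by move=> uc vc x; apply: continuous_max; [exact: uc|exact: vc]. Qed.

Lemma continuous_fct_min (u v : X -> R) :
  continuous u -> continuous v -> continuous (fun x => Num.min (u x) (v x)).
Proof. by move=> uc vc x; apply: continuous_min; [exact: uc|exact: vc]. Qed.

Lemma continuous_fct_sum (I : Type) (r : seq I) (F : I -> X -> R) :
  (forall i, continuous (F i)) -> continuous (fun x => \sum_(i <- r) F i x).
Proof.
move=> Fc; elim: r => [|i r IH].
  rewrite (_ : (fun _ => _) = (fun=> 0)); first exact: continuous_fct_cst.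
  by apply/funext => x; rewrite big_nil.
rewrite (_ : (fun _ => _) = (fun x => F i x + \sum_(j <- r) F j x)).
  exact: continuous_fct_add.
by apply/funext => x; rewrite big_cons.
Qed.

Lemma open_lt_fct u v :
  continuous u -> continuous v -> open [set x | u x < v x].
Proof.
move=> uc vc.
rewrite (_ : [set _ | _] = (fun x => v x - u x) @^-1` [set y | y > 0]).
  by apply: open_comp => // x _; exact: continuous_fct_sub.
by apply/seteqP; split=> x /=; rewrite subr_gt0.
Qed.

(** A sequence of continuous real functions on X. *)
Definition continuous_seq (g : nat -> X -> R) := forall n, continuous (g n).

(** The distance of g and h is at most e for uniform convergence on X, uniform in
    the index as well. *)
Definition uniformly_near (e : R) (g h : nat -> X -> R) :=
  forall n x, `|g n x - h n x| <= e.

(** The set P of sequences of continuous functions contains an open dense set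
    for uniform convergence. *)
Definition stably_dense (P : (nat -> X -> R) -> Prop) :=
  forall g e, continuous_seq g -> 0 < e ->
    exists g' d, [/\ continuous_seq g', uniformly_near e g g', 0 < d &
      forall g'', continuous_seq g'' -> uniformly_near d g' g'' -> P g''].

Lemma stably_dense_imp (b : Prop) (P : (nat -> X -> R) -> Prop) :
  (b -> stably_dense P) -> stably_dense (fun g => b -> P g).
Proof.
move=> dP g e gc e0; have [/dP/(_ g e gc e0)|nb] := pselect b.
  by move=> [g' [d [? ? ? gP]]]; exists g', d; split=> // g'' ? ? _; exact: gP.
by exists g, e; split=> // n x; rewrite subrr normr0 ltW.
Qed.

(** Baire's theorem for sequences of continuous functions under uniform
    convergence. The limit of the nested balls is the supremum of the lower
    bounds that they give at each point. *)
Lemma stably_dense_countable (I : countType)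
    (P : I -> (nat -> X -> R) -> Prop) (h : nat -> X -> R) (e : R) :
  (forall i, stably_dense (P i)) -> continuous_seq h -> 0 < e ->
  exists g, [/\ continuous_seq g, uniformly_near e h g & forall i, P i g].
Proof.
move=> dP hc e0.
pose T k g := if choice.unpickle k is Some i then P i g else True.
have dT k : stably_dense (T k).
  rewrite /T; case: choice.unpickle => [i|]; first exact: dP.
  by move=> g a gc a0; exists g, a; split => // n x; rewrite subrr normr0 ltW.
(* A state is the center and the radius of a closed ball. The next ball lies in
   the previous one, has at most half its radius, and lies in T k. *)
pose step (p : nat * ((nat -> X -> R) * R)) (q : (nat -> X -> R) * R) :=
  continuous_seq p.2.1 -> 0 < p.2.2 ->
  [/\ continuous_seq q.1, uniformly_near (p.2.2 / 2) p.2.1 q.1, 0 < q.2,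
    q.2 <= p.2.2 / 2 &
    forall g, continuous_seq g -> uniformly_near q.2 q.1 g -> T p.1 g].
have [F FP] : {F & forall p, step p (F p)}.
  apply: choice => -[k [g a]].
  have [[gc a0]|nga] := pselect (continuous_seq g /\ 0 < a); last first.
    by exists (g, a) => gc a0; case: nga.
  have a2 : 0 < a / 2 by rewrite divr_gt0.
  have [g' [d [gc' gg' d0 dP']]] := dT k g _ gc a2.
  exists (g', Num.min d (a / 2)) => _ _ /=; split => //.
  - by rewrite lt_min d0.
  - by rewrite ge_min lexx orbT.
  - move=> g'' gc'' gg''; apply: dP' => // n x.
    by apply: le_trans (gg'' n x) _; rewrite ge_min lexx.
pose s := fix s k := if k is j.+1 then F (j, s j) else (h, e).
pose f k := (s k).1; pose d k := (s k).2.
have sP k : continuous_seq (f k) /\ 0 < d k.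
  rewrite /f /d; elim: k => [|k [IH1 IH2]] //=.
  by have [] := FP (k, s k) IH1 IH2.
have sS k : step (k, s k) (s k.+1) := FP (k, s k).
have d_small k : d k <= e / k.+1%:R.
  elim: k => [|k IH]; first by rewrite divr1.
  have [c k0] := sP k; have [_ _ _ + _] := sS k c k0; move/le_trans; apply.
  apply: (@le_trans _ _ (e / k.+1%:R / 2)); first by rewrite ler_pM2r.
  rewrite -mulrA -invfM ler_pM2l// lef_pV2 ?posrE ?mulr_gt0 ?ltr0n//.
  by rewrite -natrM ler_nat muln2 -addnn addSn ltnS leq_addl.
have nested j k n x : f j n x - d j <= f (j + k)%N n x - d (j + k)%N /\
    f (j + k)%N n x + d (j + k)%N <= f j n x + d j.
  elim: k => [|k [IH1 IH2]]; first by rewrite addn0.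
  rewrite addnS; have [c k0] := sP (j + k)%N.
  have [_ /(_ n x) + _ + _] := sS (j + k)%N c k0.
  rewrite /= -/(f (j + k)%N) -/(d (j + k)%N) -/(f (j + k).+1) -/(d (j + k).+1).
  rewrite ler_norml => /andP[A B] C; split.
    by apply: le_trans IH1 _; lra.
  by apply: le_trans IH2; lra.
have cross j k n x : f j n x - d j <= f k n x + d k.
  have [_ j0] := sP (j + k)%N.
  have [A _] := nested j k n x; have [_ B] := nested k j n x.
  rewrite addnC in B; apply: le_trans A _; apply: le_trans B; lra.
pose g n x := sup [set f k n x - d k | k in setT].
have g_near k : uniformly_near (d k) (f k) g.
  move=> n x; rewrite distrC ler_distl; apply/andP; split.
    apply: ub_le_sup; last by exists k.
    by exists (f 0%N n x + d 0%N) => _ [j _ <-].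
  apply: ge_sup; first by exists (f 0%N n x - d 0%N), 0%N.
  by move=> _ [j _ <-].
have gc : continuous_seq g.
  move=> n x; apply/cvgrPdist_lt => eps eps0.
  have [k ke] : exists k, d k < eps / 3.
    have eps3 : 0 < eps / 3 by rewrite divr_gt0.
    exists (Num.bound (e / (eps / 3))); apply: le_lt_trans (d_small _) _.
    rewrite ltr_pdivrMr ?ltr0n// mulrC -ltr_pdivrMr//.
    apply: lt_le_trans (archi_boundP _) _; first by rewrite divr_ge0 ?ltW.
    by rewrite ler_nat.
  have [c _] := sP k.
  have := c n x; move/cvgrPdist_lt => /(_ (eps / 3)).
  have -> : 0 < eps / 3 by rewrite divr_gt0.
  move=> /(_ isT); apply: filterS => y.
  have := g_near k n x; have := g_near k n y.
  rewrite ler_norml => /andP[A1 A2]; rewrite ler_norml => /andP[B1 B2].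
  rewrite ltr_norml => /andP[C1 C2].
  rewrite ltr_norml; apply/andP; split; lra.
exists g; split => //; first exact: (g_near 0%N).
move=> i; have [c k0] := sP (choice.pickle i).
have [_ _ _ _] := sS (choice.pickle i) c k0; rewrite /T /= choice.pickleK; apply => //.
exact: (g_near (choice.pickle i).+1).
Qed.

End RealFunctions.

(** * Unstable zeros *)

Section UnstableZeros.
Context {R : realType} {X : topologicalType}.

(** The origin is an unstable value of every continuous map from X to R^k:
    an arbitrarily small perturbation of the map avoids it. In metric spaces,
    this is equivalent to dim X < k. *)
Definition unstable_zeros (k : nat) :=
  forall (f : 'I_k -> X -> R) (e : R), (forall i, continuous (f i)) -> 0 < e ->
  exists g : 'I_k -> X -> R, [/\ forall i, continuous (g i),
    forall i x, `|g i x - f i x| <= e & forall x, exists i, g i x != 0].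

(** A map to R^k without zeros becomes bounded away from 0 after being pushed
    radially out of a small ball. *)
Lemma push_off_zero (k : nat) (g : 'I_k -> X -> R) (e : R) :
  (forall i, continuous (g i)) -> 0 < e -> (forall x, exists i, g i x != 0) ->
  exists h d, [/\ forall i, continuous (h i),
    forall i x, `|h i x - g i x| <= e, 0 < d &
    forall x, exists i, d <= `|h i x|].
Proof.
move=> gc e0 g_neq0.
pose nrm x := \sum_i `|g i x|.
have nrm_ge i x : `|g i x| <= nrm x.
  by rewrite /nrm (bigD1 i)//= lerDl sumr_ge0.
have nrm_gt0 x : 0 < nrm x.
  have [i gi] := g_neq0 x; apply: lt_le_trans (nrm_ge i x).
  by rewrite normr_gt0.
have nrm_cont : continuous nrm.
  by apply: continuous_fct_sum => i; apply: continuous_fct_norm.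
pose c x := Num.max (nrm x) e * (nrm x)^-1.
have c_ge0 x : 0 <= c x.
  by rewrite mulr_ge0 ?invr_ge0 ?ltW// lt_max nrm_gt0.
exists (fun i x => g i x * c x), (e / k.+1%:R); split=> [i|i x||x].
- apply: continuous_fct_mul => //; apply: continuous_fct_mul.
    by apply: continuous_fct_max => //; exact: continuous_fct_cst.
  by apply: continuous_fct_inv => // x; rewrite gt_eqF.
- have -> : g i x * c x - g i x = g i x * ((Num.max (nrm x) e - nrm x) / nrm x).
    by rewrite /c; field; rewrite gt_eqF.
  have max_ge0 : 0 <= Num.max (nrm x) e - nrm x by rewrite subr_ge0 le_max lexx.
  rewrite normrM [X in _ * X]ger0_norm ?divr_ge0 ?(ltW (nrm_gt0 x))//.
  rewrite mulrCA; apply: (@le_trans _ _ (Num.max (nrm x) e - nrm x)).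
    by rewrite ler_piMr// ler_pdivrMr// mul1r.
  rewrite lerBlDr ge_max lerDr (ltW e0)/= lerDl; exact: ltW.
- by rewrite divr_gt0.
- apply/existsP; apply: contraT; rewrite negb_exists => /forallP small.
  have : \sum_i `|g i x * c x| <= \sum_(i < k) (e / k.+1%:R).
    by apply: ler_sum => i _; rewrite ltW// ltNge.
  under eq_bigr do rewrite normrM [X in _ * X]ger0_norm//.
  rewrite -mulr_suml -/(nrm x) sumr_const card_ord -[X in _ <= X]mulr_natr /c mulrCA.
  rewrite divff ?gt_eqF// mulr1 leNgt => /negP[].
  apply: (@lt_le_trans _ _ e); last by rewrite le_max lexx orbT.
  by rewrite -mulrA gtr_pMr// mulrC ltr_pdivrMr ?ltr0n// mul1r ltr_nat.
Qed.

Lemma update_seq (T : Type) (k : nat) (s : 'I_k -> nat) (F : 'I_k -> T)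
    (g : nat -> T) : injective s ->
  exists h : nat -> T, (forall i, h (s i) = F i) /\
    (forall n, (exists i, s i = n) \/ h n = g n).
Proof.
move=> s_inj; exists (fun n => if [pick i | s i == n] is Some i then F i else g n).
split=> [i|n]; case: pickP => [j /eqP|] //.
- by move/s_inj ->.
- by move/(_ i); rewrite eqxx.
- by left; exists j.
- by right.
Qed.

(** The function g_n if o = Some n, and zero if o = None. *)
Definition base_fct (o : option nat) (g : nat -> X -> R) : X -> R :=
  if o is Some n then g n else fun=> 0.

(** Generically, at no point do k functions of a sequence all agree with one
    further function of the sequence (for o = Some n), or all vanish (for
    o = None). *)
Lemma stably_dense_no_coincidence (k : nat) (o : option nat)
    (s : k.-tuple nat) :
  unstable_zeros k -> uniq s -> (if o is Some n then n \notin s else true) ->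
  stably_dense (fun g : nat -> X -> R =>
    forall x, exists i, g (tnth s i) x != base_fct o g x).
Proof.
move=> unst /tuple_uniqP s_inj os g e gc e0.
have e2 : 0 < e / 2 by rewrite divr_gt0.
have oc h : continuous_seq h -> continuous (base_fct o h).
  by rewrite /base_fct; case: (o) => // _; exact: continuous_fct_cst.
have [|f [fc fg f0]] := unst (fun i x => g (tnth s i) x - base_fct o g x) _ _ e2.
  by move=> i; apply: continuous_fct_sub => //; exact: oc.
have [h [d [hc hf d0 hd]]] := push_off_zero fc e2 f0.
have [g' [g's g'n]] := update_seq (fun i x => h i x + base_fct o g x) g s_inj.
have og' : base_fct o g' = base_fct o g.
  case: (o) os => //= n ns; have [[i sin]|//] := g'n n.
  by move: ns; rewrite -sin mem_tnth.
exists g', (d / 3); split => //.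
- move=> n; have [[i <-]|->] := g'n n; last exact: gc.
  by rewrite g's; apply: continuous_fct_add => //; exact: oc.
- move=> n x; have [[i <-]|->] := g'n n; last by rewrite subrr normr0 ltW.
  rewrite g's; have := hf i x; have := fg i x; rewrite !ler_distl.
  by move=> /andP[? ?] /andP[? ?]; apply/andP; split; lra.
- by rewrite divr_gt0.
- move=> g'' gc'' g'g'' x; have [i di] := hd x; exists i.
  apply: contraTneq di => eq_base; rewrite -ltNge.
  have near_base : `|base_fct o g' x - base_fct o g'' x| <= d / 3.
    by case: (o) => [n|] /=; [exact: g'g''|rewrite subrr normr0 divr_ge0// ltW].
  have := g'g'' (tnth s i) x; rewrite g's eq_base.
  move: near_base; rewrite og' !ler_distl => /andP[? ?] /andP[? ?].
  by rewrite ltr_norml; apply/andP; split; lra.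
Qed.

End UnstableZeros.
Arguments unstable_zeros R X k : clear implicits.

(** * Partitions of unity in metric spaces *)

Section PartitionOfUnity.
Context {R : realType} {X : metricType R}.

Lemma continuous_mdist (p : X) : continuous (mdist p : X -> R).
Proof.
move=> x; apply/cvgrPdist_lt => e e0.
have := nbhsx_ballx x e e0; apply: filterS => y; rewrite ballEmdist/= => xy.
have := metric_triangle p x y; have := metric_triangle p y x.
rewrite [mdist y x]metric_sym => A B.
by rewrite ltr_norml; apply/andP; split; lra.
Qed.

(** The function is the distance to the complement of V, truncated at 1 so
    that V = X needs no special treatment. *)
Lemma open_bump (V : set X) : open V ->
  exists b : X -> R, [/\ continuous b, forall x, 0 <= b x &
    forall x, (0 < b x) <-> V x].
Proof.
move=> Vo.
pose D x := [set r : R | r = 1 \/ exists2 y, ~ V y & r = mdist x y].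
have D1 x : D x 1 by left.
have D_ge0 x : lbound (D x) 0.
  by move=> _ [->|[y _ ->]]; [exact: ler01|exact: mdist_ge0].
have D_lb x : has_lbound (D x) by exists 0.
have lip x y : inf (D x) <= inf (D y) + mdist x y.
  rewrite -lerBlDr; apply: lb_le_inf; first by exists 1.
  move=> _ [->|[z Vz ->]]; rewrite lerBlDr.
    apply: le_trans (ge_inf (D_lb x) (D1 x)) _.
    by rewrite lerDl mdist_ge0.
  have xz : D x (mdist x z) by right; exists z.
  apply: le_trans (ge_inf (D_lb x) xz) _.
  by rewrite addrC; exact: metric_triangle.
exists (fun x => inf (D x)); split=> [x|x|x].
- apply/cvgrPdist_lt => e e0.
  have := nbhsx_ballx x e e0; apply: filterS => y; rewrite ballEmdist/= => xy.
  have := lip x y; have := lip y x; rewrite [mdist y x]metric_sym => A B.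
  by rewrite ltr_norml; apply/andP; split; lra.
- by apply: lb_le_inf; [exists 1|exact: D_ge0].
- split=> [Dx|Vx].
    apply: contrapT => Vx; move: Dx; rewrite ltNge => /negP; apply.
    by apply: ge_inf => //; right; exists x => //; rewrite mdistxx.
  have /nbhs_ballP[e /= e0 eV] : nbhs x V by exact: open_nbhs_nbhs.
  apply: (@lt_le_trans _ _ (Num.min 1 e)); first by rewrite lt_min ltr01.
  apply: lb_le_inf; first by exists 1.
  move=> _ [->|[y Vy ->]]; first by rewrite ge_min lexx.
  rewrite ge_min; apply/orP; right; rewrite leNgt; apply/negP => xy.
  by apply/Vy/eV; rewrite ballEmdist.
Qed.

Lemma partition_of_unity (N : nat) (V : 'I_N -> set X) :
  (forall i, open (V i)) -> (forall x, exists i, V i x) ->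
  exists phi : 'I_N -> X -> R, [/\ forall i, continuous (phi i),
    forall i x, 0 <= phi i x, forall i x, phi i x != 0 -> V i x &
    forall x, \sum_i phi i x = 1].
Proof.
move=> Vo Vcov.
have [b bP] := choice (fun i => open_bump (Vo i)).
pose sb x := \sum_i b i x.
have sb_gt0 x : 0 < sb x.
  have [i Vi] := Vcov x; have [_ _ bV] := bP i.
  rewrite /sb (bigD1 i)//= ltr_pwDl ?sumr_ge0//; first exact/bV.
  by move=> j _; have [_ b0 _] := bP j.
have sbV_ge0 x : 0 <= (sb x)^-1 by rewrite invr_ge0 ltW.
exists (fun i x => b i x * (sb x)^-1); split=> [i|i x|i x|x].
- apply: continuous_fct_mul; first by have [] := bP i.
  apply: continuous_fct_inv => [|x]; last by rewrite gt_eqF.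
  by apply: continuous_fct_sum => j; have [] := bP j.
- by rewrite mulr_ge0//; have [_ b0 _] := bP i.
- have [_ b0 bV] := bP i; rewrite mulf_eq0 negb_or => /andP[bx _].
  by apply: (bV x).1; rewrite lt_neqAle eq_sym bx b0.
- by rewrite -mulr_suml -/(sb x) divff// gt_eqF.
Qed.

End PartitionOfUnity.

(** A finite open cover of order at most k, listed with k copies of the
    empty set added so as to have at least k members. *)
Lemma finite_cover_index (X : topologicalType) (V : set (set X)) (k : nat) :
  finite_open_cover V -> (forall x, [set B | V B /\ B x] #<= `I_k) ->
  exists (N : nat) (W : 'I_N -> set X), [/\ (k <= N)%N,
    forall i, open (W i), forall x, exists i, W i x,
    forall i, V (W i) \/ W i = set0 &
    forall x, (#|[set i | `[< W i x >]]%SET| <= k)%N].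
Proof.
move=> [/finite_seqP[s0 Vs0] Vo Vcov] Vord.
pose s := undup s0.
have Vs : V = [set` s] by rewrite Vs0; apply/seteqP; split=> B /=; rewrite mem_undup.
have V_nth i : (i < size s)%N -> V (nth set0 s i) by rewrite Vs/=; exact: mem_nth.
exists (size s + k)%N, (fun i => nth set0 s i); split=> [|i|x|i|x].
- exact: leq_addl.
- have [si|si] := ltnP i (size s); first exact/Vo/V_nth.
  by rewrite nth_default//; exact: open0.
- have : (\bigcup_(A in V) A) x by rewrite Vcov.
  move=> [B]; rewrite Vs/= => Bs Bx.
  have iB : (index B s < size s + k)%N by rewrite ltn_addr// index_mem.
  by exists (Ordinal iB); rewrite /= nth_index.
- have [si|si] := ltnP i (size s); first by left; exact/V_nth.
  by right; rewrite nth_default.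
- rewrite -card_le_ord_set; apply: card_le_trans (Vord x).
  have W_inj : {in [set` [set i : 'I_(size s + k) | `[< nth set0 s i x >]]%SET] &,
      injective (fun i : 'I_(size s + k) => nth set0 s i)}.
    move=> i j; rewrite !in_setE/= !finset.in_set => /asboolP ix /asboolP jx ij.
    apply/val_inj/eqP; rewrite -(nth_uniq set0 _ _ (undup_uniq s0)) ?ij//.
      by rewrite ltnNge; apply/negP => si; rewrite nth_default in ix.
    by rewrite ltnNge; apply/negP => si; rewrite nth_default in jx.
  rewrite -(card_le_eql (inj_card_eq W_inj)).
  apply: subset_card_le => _ [i /= + <-]; rewrite inE => /asboolP ix.
  split=> //; apply: V_nth; rewrite ltnNge; apply/negP => si.
  by rewrite nth_default in ix.
Qed.

(** * Covering dimension and unstable zeros *)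

Section DimensionAndInstability.
Context {R : realType} {X : metricType R}.

(** If dim X < k, any map f : X -> R^k avoids 0 after a small perturbation.
    The space is covered by the open sets on which each f_j is either greater
    than - e/8 or less than e/8. On such a set each f_j, clipped to [- e, e],
    is almost constant in that it is within e/2 + e/8 of e/2 or of - e/2. A
    refinement of order k, with a partition of unity phi, then gives a map
    g = \sum_i phi_i w_i whose components are within 3/4 e of those of the clipped
    f, where the points w_i are in general position. Adding to f the difference
    between g and the clipped f gives a map that equals g wherever it vanishes.
    Since at each point at most k of the phi_i are nonzero, independence of any k
    of the w_i forbids g to vanish. *)
Lemma dim_lt_unstable_zeros (k : nat) :
  covering_dim_lt X k -> unstable_zeros R X k.
Proof.
move=> dimX f e fc e0.
pose eta := e / 8.
have eta0 : 0 < eta by rewrite divr_gt0.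
pose U (kap : {ffun 'I_k -> bool}) : set X :=
  [set x | forall j, if kap j then - eta < f j x else f j x < eta].
have Ucov : finite_open_cover [set U kap | kap in setT].
  split.
  - exact/finite_image/finite_finset.
  - move=> _ [kap _ <-]; rewrite openE => x Ux.
    have : \forall y \near x, forall j, if kap j then - eta < f j y else f j y < eta.
      apply: filter_forall => j; have := Ux j; case: ifP => _ fjx.
        apply: (@open_nbhs_nbhs _ x [set y | - eta < f j y]); split => //.
        by apply: open_lt_fct => //; exact: continuous_fct_cst.
      apply: (@open_nbhs_nbhs _ x [set y | f j y < eta]); split => //.
      by apply: open_lt_fct => //; exact: continuous_fct_cst.
    exact.
  - apply/seteqP; split=> // x _.
    exists (U [ffun j => 0 <= f j x]); first by exists [ffun j => 0 <= f j x].
    move=> j; rewrite ffunE; case: (leP 0 (f j x)) => fjx; last exact: lt_trans fjx eta0.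
    by apply: lt_le_trans fjx; rewrite oppr_lt0.
have [V [Vcov Vref Vord]] := dimX _ Ucov.
have [N [W [kN Wo Wcov WV Word]]] := finite_cover_index Vcov Vord.
have [kap kapP] : {kap : 'I_N -> {ffun 'I_k -> bool} & forall i, W i `<=` U (kap i)}.
  apply: (@choice _ _ (fun i kap => W i `<=` U kap)) => i.
  have [VWi|->] := WV i; last by exists [ffun=> true].
  by have [_ [kap _ <-] WU] := Vref _ VWi; exists kap.
have [phi [phic phi_ge0 phiW phi1]] := partition_of_unity Wo Wcov.
have [w [wv w_free]] := general_position
  (fun i => \row_j (if kap i j then e / 2 else - (e / 2)) : 'rV[R]_k) eta0.
pose clip j x := Num.max (- e) (Num.min e (f j x)).
pose g j x := \sum_i phi i x * w i 0 j.
have near_w i j x : phi i x != 0 -> `|w i 0 j - clip j x| <= 3 / 4 * e.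
  move=> /phiW /kapP /(_ j); have := wv i j; rewrite mxE.
  rewrite /clip !ler_distl /eta => /andP[A B].
  case: (kap i j) A B => /= A B C; apply/andP; split;
    case: (leP e (f j x)) => ?; case: (leP (- e) _) => ?; lra.
have g_near j x : `|g j x - clip j x| <= 3 / 4 * e.
  have -> : g j x - clip j x = \sum_i phi i x * (w i 0 j - clip j x).
    under [RHS]eq_bigr do rewrite mulrBr.
    by rewrite sumrB -mulr_suml phi1 mul1r.
  apply: le_trans (ler_norm_sum _ _ _) _.
  apply: (@le_trans _ _ (\sum_i phi i x * (3 / 4 * e))); last first.
    by rewrite -mulr_suml phi1 mul1r.
  apply: ler_sum => i _; rewrite normrM (ger0_norm (phi_ge0 i x)).
  have [->|phi0] := eqVneq (phi i x) 0; first by rewrite !mul0r.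
  by rewrite ler_wpM2l// near_w.
exists (fun j x => f j x + (g j x - clip j x)); split=> [j|j x|x].
- apply: continuous_fct_add => //; apply: continuous_fct_sub.
    apply: continuous_fct_sum => i; apply: continuous_fct_mul => //.
    exact: continuous_fct_cst.
  apply: continuous_fct_max; first exact: continuous_fct_cst.
  by apply: continuous_fct_min => //; exact: continuous_fct_cst.
- rewrite addrAC subrr add0r; apply: le_trans (g_near j x) _; lra.
apply: contrapT => no_i.
have g0 j : g j x = 0.
  have fgc : f j x + (g j x - clip j x) = 0.
    by apply/eqP/negPn/negP => ?; apply: no_i; exists j.
  have := g_near j x; rewrite ler_norml => /andP[A B].
  suff : clip j x = f j x by move=> cf; move: fgc; rewrite cf; lra.
  have : `|f j x| < e by rewrite ltr_norml; apply/andP; split; lra.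
  rewrite /clip ltr_norml => /andP[? ?].
  by rewrite (min_idPr (ltW _))// (max_idPr (ltW _)).
pose J := [set i | `[< W i x >]]%SET.
have [|s [s_inj sJ]] := @enum_set_into N k J; first by rewrite Word.
have sum_s (F : 'I_N -> R) : \sum_i phi i x * F i = \sum_j phi (s j) x * F (s j).
  rewrite (bigID (mem (s @: [set: 'I_k]%SET)))/= [X in _ + X]big1 ?addr0.
    rewrite big_imset/=; last by move=> i j _ _; exact: s_inj.
    by apply: eq_bigl => j; rewrite finset.in_setT.
  move=> i; apply: contraNeq; rewrite mulf_eq0 negb_or => /andP[/phiW Wi _].
  have [|j <-] := sJ i; first by rewrite finset.in_set; exact/asboolP.
  by apply: imset_f; rewrite finset.in_setT.
have y0 : \row_j phi (s j) x *m (\matrix_(j < k) w (s j)) = 0.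
  apply/rowP => j; rewrite !mxE -[RHS](g0 j) /g sum_s.
  by apply: eq_bigr => i _; rewrite !mxE.
have /rowP y00 : \row_j phi (s j) x = 0 :> 'rV[R]_k.
  by apply: (row_free_inj (w_free s s_inj)); rewrite y0 mul0mx.
have /eqP := phi1 x; apply/negP; rewrite eq_sym.
under eq_bigr do rewrite -[phi _ _]mulr1; rewrite (sum_s (fun=> 1)) big1 ?oner_neq0//.
by move=> j _; have := y00 j; rewrite !mxE => ->; rewrite mul0r.
Qed.

(** Conversely, let phi_i be a partition of unity subordinate to a finite open
    cover, perturbed so that no k + 1 of the phi_i coincide at any point. The
    sets on which phi_i is not too small and at most k of the phi_j are greater
    than or equal to phi_i then form an open refinement of order k. *)
Lemma unstable_zeros_dim_lt (k : nat) :
  unstable_zeros R X k -> covering_dim_lt X k.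
Proof.
move=> unst U Ucov.
have [Ufin Uo _] := Ucov; have [n Un] := (finite_setP U).1 Ufin.
have Uord (x : X) : [set B | U B /\ B x] #<= `I_n.
  by rewrite -(card_le_eqr Un); apply: subset_card_le => B [].
have [N [W [_ Wo Wcov WU _]]] := finite_cover_index Ucov Uord.
have [phi [phic phi_ge0 phiW phi1]] := partition_of_unity Wo Wcov.
pose h (i : nat) x := if insub i is Some j then phi j x else 0.
have hc : continuous_seq h.
  move=> i; rewrite /h; case: insub => [j|]; first exact: phic.
  exact: continuous_fct_cst.
(* Some phi_i x is at least 2 c, since they add up to 1. *)
pose c : R := (2 * N.+1%:R)^-1.
have c0 : 0 < c by rewrite invr_gt0 mulr_gt0.
have c2 : 0 < c / 2 by rewrite divr_gt0.
pose P (ns : nat * k.-tuple nat) (g : nat -> X -> R) :=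
  uniq (ns.1 :: ns.2) -> forall x, exists i, g (tnth ns.2 i) x != g ns.1 x.
have dP ns : stably_dense (P ns).
  apply: stably_dense_imp => /= /andP[nns s_uniq].
  exact: (@stably_dense_no_coincidence _ _ _ (Some ns.1) _ unst s_uniq nns).
have [g [gc gh gP]] := stably_dense_countable dP hc c2.
have {}gh (i : 'I_N) x : `|g i x - phi i x| <= c / 2.
  by rewrite distrC; have := gh i x; rewrite /h valK.
pose T (i : 'I_N) x := [set j : 'I_N | g i x <= g j x]%SET.
pose V (i : 'I_N) := [set x | c < g i x /\ (#|T i x| <= k)%N].
have VW i : V i `<=` W i.
  move=> x [cg _]; apply: phiW; apply: contraTneq cg => phi0.
  by have := gh i x; rewrite phi0 subr0 -leNgt ler_norml => /andP[_ ?]; lra.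
have Vo i : open (V i).
  rewrite openE => x [cg Tk].
  have near_c : \forall y \near x, c < g i y.
    apply: (@open_nbhs_nbhs _ x [set y | c < g i y]); split => //.
    by apply: open_lt_fct => //; exact: continuous_fct_cst.
  have near_T : \forall y \near x, forall j : 'I_N, g j x < g i x -> g j y < g i y.
    apply: filter_forall => j.
    have [gij|gij] := ltP (g j x) (g i x); last exact: filterE.
    apply: (@filterS _ _ _ [set y | g j y < g i y]) => //.
    by apply: open_nbhs_nbhs; split=> //; exact: open_lt_fct.
  apply: filterS2 near_c near_T => y cy Ty; split => //.
  apply: leq_trans Tk; apply/subset_leq_card/fintype.subsetP => j.
  by rewrite !finset.in_set !leNgt; apply: contra; exact: Ty.
have Vcov x : exists i, V i x.
  have N0 : (0 < N)%N by have [i _] := Wcov x; apply: leq_trans (ltn_ord i).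
  pose i := [arg max_(i > Ordinal N0) g i x]%O.
  have imax (j : 'I_N) : g j x <= g i x by rewrite /i; case: arg_maxP => // ? _; apply.
  exists i; split.
    have [j phij] : exists j, 2 * c <= phi j x.
      apply/existsP; apply: contraT; rewrite negb_exists => /forallP small.
      have : \sum_j phi j x <= \sum_(j < N) (2 * c).
        by apply: ler_sum => j _; rewrite ltW// ltNge.
      rewrite phi1 sumr_const card_ord /c invfM mulrA divff// mul1r.
      rewrite -[X in _ <= X]mulr_natr mulrC ler_pdivlMr ?ltr0n// mul1r.
      by rewrite ler_nat ltnn.
    apply: lt_le_trans (imax j).
    have := gh j x; rewrite ler_norml => /andP[? ?]; lra.
  rewrite leqNgt; apply/negP => kT.
  have [l [l_uniq size_l lT]] := card_geqP kT.
  case: l l_uniq size_l lT => // a s s_uniq [size_s] sT.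
  have tieT (j : 'I_N) : j \in a :: s -> g j x = g i x.
    by move/sT; rewrite finset.in_set => gij; apply/eqP; rewrite eq_le imax gij.
  have size_vs : size (map val s) == k by rewrite size_map size_s.
  have /= [|j] := gP (val a, Tuple size_vs) _ x.
    rewrite -[_ && _]/(uniq (map val (a :: s))) map_inj_uniq//; exact: val_inj.
  have : tnth (Tuple size_vs) j \in map val s by rewrite (mem_tnth j (Tuple size_vs)).
  move=> /mapP[b bs ->]; rewrite (tieT a) ?inE ?eqxx// => /eqP[].
  by apply: tieT; rewrite inE bs orbT.
exists [set V i | i in [set i | V i !=set0]]; split.
- split; first exact/finite_image/finite_finset.
    by move=> _ [i _ <-]; exact: Vo.
  apply/seteqP; split=> // x _; have [i Vi] := Vcov x.
  by exists (V i) => //; exists i => //; exists x.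
- move=> _ [i [x Vi] <-]; have [UWi|W0] := WU i; first by exists (W i).
  by have := VW i x Vi; rewrite W0.
- move=> x.
  pose J := [set i | `[< V i x >]]%SET.
  apply: (@card_le_trans _ _ _ [set V i | i in [set` J]]).
    apply: subset_card_le => _ [[i _ <-] Vi]; exists i => //=.
    by rewrite finset.in_set; exact/asboolP.
  apply: card_le_trans (card_image_le _ _) _.
  rewrite card_le_ord_set.
  have [/eqP|[i0 Ji0]] := set_0Vmem J; first by rewrite -cards_eq0 => /eqP ->.
  pose i := [arg min_(i < i0 in J) g i x]%O.
  have [Ji imin] : i \in J /\ forall j, j \in J -> g i x <= g j x.
    by rewrite /i; case: arg_minP.
  have := Ji; rewrite finset.in_set => /asboolP[_]; apply: leq_trans.
  by apply/subset_leq_card/fintype.subsetP => j Jj; rewrite finset.in_set imin.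
Qed.

End DimensionAndInstability.

(** * Dyadic families defined by signs *)

Section SignSets.
Context {R : realType} {X : topologicalType}.
Implicit Types (g : nat -> X -> R) (s : nat -> option bool) (A B : set X).

(** The real number r counted positively for the side true, negatively for the
    side false. *)
Definition signed (b : bool) (r : R) : R := if b then r else - r.

Lemma signed_eq0 b r : (signed b r == 0) = (r == 0).
Proof. by case: b; rewrite /signed ?oppr_eq0. Qed.

(** The dyadic family attached to a sequence of real functions: S_{n,1} is the
    set where g_n is positive and S_{n,0} the set where it is negative. *)
Definition sign_sets g (n : nat) (b : bool) : set X :=
  [set x | 0 < signed b (g n x)].

Lemma continuous_signed g n b :
  continuous_seq g -> continuous (fun x => signed b (g n x)).
Proof.
move=> gc; rewrite /signed; case: b; first exact: gc.
by move=> x; apply: cvgN; exact: gc.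
Qed.

Lemma open_sign_sets g n b : continuous_seq g -> open (sign_sets g n b).
Proof.
move=> gc; apply: open_lt_fct; first exact: continuous_fct_cst.
exact: continuous_signed.
Qed.

(** Either B contains a point where the functions g_n, for n in dom s, have the
    signs prescribed by s, or these functions have no common zero in B. *)
Definition crossing s B g :=
  (exists2 y, B y & forall n b, s n = Some b -> sign_sets g n b y) \/
  (forall x, B x -> exists2 n, s n != None & g n x != 0).

(** If the g_n, for n in dom s, are not bounded away from 0 simultaneously on B,
    adding small constants of the prescribed signs makes the first alternative
    hold. Otherwise the second alternative is stable at g. *)
Lemma stably_dense_crossing s B : stably_dense (crossing s B).
Proof.
move=> g e gc e0.
have [[d d0 gd]|nd] := pselect (exists2 d, 0 < d &
    forall x, B x -> exists2 n, s n != None & d <= `|g n x|).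
  exists g, (d / 2); split=> //; first by move=> n x; rewrite subrr normr0 ltW.
    by rewrite divr_gt0.
  move=> g' _ gg'; right=> x /gd[n sn dg]; exists n => //.
  apply: contraTneq dg => g'0; rewrite -ltNge.
  by have := gg' n x; rewrite g'0 subr0 => /le_lt_trans; apply; lra.
have e2 : 0 < e / 2 by rewrite divr_gt0.
have [x [Bx gx]] : exists x, B x /\ forall n, s n != None -> `|g n x| < e / 2.
  apply: contrapT => nx; apply: nd; exists (e / 2) => // x Bx.
  apply: contrapT => nn; apply: nx; exists x; split=> // n sn.
  by rewrite ltNge; apply/negP => eg; apply: nn; exists n.
pose a n : R := if s n is Some b then signed b e else 0.
exists (fun n x => g n x + a n), (e / 4); split.
- by move=> n; apply: continuous_fct_add => //; exact: continuous_fct_cst.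
- move=> n y; rewrite opprD addrA subrr add0r normrN /a.
  case: (s n) => [[]|]; rewrite /signed ?normrN ?normr0 ?(gtr0_norm e0)//.
  exact: ltW.
- by rewrite divr_gt0.
- move=> g' _ gg'; left; exists x => // n b sn; rewrite /sign_sets/=.
  have := gx n; rewrite sn => /(_ isT); have := gg' n x; rewrite /a sn.
  rewrite ltr_norml ler_norml /signed.
  by case: b {sn} => /andP[? ?] /andP[? ?]; lra.
Qed.

(** Every sign pattern on finitely many of the g_n occurs arbitrarily close to
    each of their common zeros. *)
Definition crossing_zeros g := forall s B x, finite_set (tdom s) -> nbhs x B ->
  (forall n, s n != None -> g n x = 0) ->
  exists2 y, B y & forall n b, s n = Some b -> sign_sets g n b y.

Section Crossing.
Variable g : nat -> X -> R.
Hypotheses (gc : continuous_seq g) (gX : crossing_zeros g).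

Lemma crossing_zeros1 n b B x : nbhs x B -> g n x = 0 ->
  exists2 y, B y & sign_sets g n b y.
Proof.
move=> Bx gx; pose s k := if k == n then Some b else None.
have [|k|y By sy] := @gX s B x _ Bx.
- apply: (@sub_finite_set _ _ [set n]); last exact: finite_set1.
  by move=> k; rewrite /tdom /s/=; case: (eqVneq k n).
- by rewrite /s; case: (eqVneq k n) => [->|].
by exists y => //; apply: sy; rewrite /s eqxx.
Qed.

Lemma closure_sign_sets n b :
  closure (sign_sets g n b) = [set x | 0 <= signed b (g n x)].
Proof.
apply/seteqP; split=> x /=.
  move=> clx; rewrite leNgt; apply/negP => gx.
  have [|y [/= y1]] := clx (sign_sets g n (~~ b)).
    apply: open_nbhs_nbhs; split; first exact: open_sign_sets.
    by move: gx; rewrite /sign_sets /signed/=; case: b {clx} => /=; lra.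
  by move: y1; rewrite /sign_sets /signed/=; case: b {clx gx} => /=; lra.
rewrite le_eqVlt => /orP[|gx B Bx]; last first.
  by exists x; split=> //; exact: nbhs_singleton.
rewrite eq_sym signed_eq0 => /eqP gx B Bx.
by have [y By yS] := crossing_zeros1 b Bx gx; exists y.
Qed.

Lemma regopen_sign_sets n b : regopen (sign_sets g n b).
Proof.
rewrite /regopen closure_sign_sets; apply/seteqP; split=> x; last first.
  move=> gx; apply: (@filterS _ _ _ (sign_sets g n b)).
    by move=> y; exact: ltW.
  by apply: open_nbhs_nbhs; split=> //; exact: open_sign_sets.
move=> Ix; have := nbhs_singleton Ix; rewrite /= le_eqVlt => /orP[|//].
rewrite eq_sym signed_eq0 => /eqP gx.
have [y /= y1] := crossing_zeros1 (~~ b) Ix gx.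
by move: y1; rewrite /sign_sets /signed/=; case: b {Ix} => /=; lra.
Qed.

Lemma exterior_sign_sets n :
  sign_sets g n true = exterior (sign_sets g n false).
Proof.
rewrite /exterior closure_sign_sets /sign_sets /signed.
apply/seteqP; split=> x /=; rewrite oppr_ge0 ltNge; first by move/negP.
by move=> ?; apply/negP.
Qed.

Lemma proper_sign_sets : proper_subbase (sign_sets g).
Proof.
move=> s s_fin; apply/seteqP; split.
  move=> x clx k ks; have : tinter (sign_sets g) s `<=`
      (if s k is Some i then sign_sets g k i else setT) by move=> y /(_ k ks).
  move/closureS => /(_ x clx); case: (s k) => //.
move=> x sx B Bx.
have [l sl] := (finite_seqP (tdom s)).1 s_fin.
have {}sl k : s k != None -> k \in l by move=> sk; have : tdom s k by []; rewrite sl.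
(* The functions vanishing at x are handled by crossing, the other ones keep
   their sign near x. *)
pose s' n := if g n x == 0 then s n else None.
have near_nz : \forall y \near x, forall i : seq_sub l, forall b,
    s (val i) = Some b -> g (val i) x != 0 -> sign_sets g (val i) b y.
  apply: filter_forall => i; apply: filter_forall => b.
  have [gi0|gi0] := eqVneq (g (val i) x) 0; first by apply: nearW => y _ /eqP.
  have [si|/eqP nsi] := eqVneq (s (val i)) (Some b); last exact: nearW.
  apply: (@filterS _ _ _ (sign_sets g (val i) b)) => //.
  apply: open_nbhs_nbhs; split; first exact: open_sign_sets.
  have si0 : (val i) \in tdom s by rewrite in_setE /tdom/= si.
  rewrite in_setE in si0.
  have := sx _ si0; rewrite si closure_sign_sets/= le_eqVlt.
  by rewrite eq_sym signed_eq0 (negbTE gi0).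
have [|n|y [By ynz] ys'] := @gX s' _ x _ (filterI Bx near_nz).
- apply: sub_finite_set s_fin => n; rewrite /tdom /s'/=; case: ifP => //.
- by rewrite /s'; case: (eqVneq (g n x) 0).
exists y; split=> // k ks; case sk: (s k) => [b|//].
have [gk0|gk0] := eqVneq (g k x) 0; first by apply: ys'; rewrite /s' gk0 eqxx.
by apply: (ynz (SeqSub (sl k ks))).
Qed.

End Crossing.
End SignSets.

(** * Existence of the subbase *)

Lemma subbase_sign_sets (R : realType) (X : topologicalType)
    (g : nat -> X -> R) : continuous_seq g ->
  (forall x A, nbhs x A -> exists2 n, sign_sets g n false x &
    sign_sets g n false `<=` A) ->
  is_subbase (sign_sets g).
Proof.
move=> gc gA; split=> [_ [D _ <-]|x A xA].
  rewrite openE => x Dx.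
  apply: (@filter_bigI _ _ D (fun p => sign_sets g p.1 p.2) (nbhs x)).
  move=> [n b] nD; apply: open_nbhs_nbhs; split; first exact: open_sign_sets.
  exact: (Dx (n, b)).
have [n nx nA] := gA x A xA.
exists (sign_sets g n false) => //; split=> //.
exists [fset (n, false)]%fset.
  by move=> p _; rewrite in_setE.
by rewrite set_fset1 bigcap_set1.
Qed.

Lemma separable_dense_seq (R : realType) (X : metricType R) :
  [set: X] !=set0 -> separable_space X ->
  exists d : nat -> X, forall x e, 0 < e -> exists n, mdist (d n) x < e.
Proof.
move=> [x0 _] [D /countable_injP[f f_inj] Ddense].
have [d dP] : {d : nat -> X & forall n, forall y, D y -> f y = n -> d n = y}.
  apply: (@choice _ _ (fun n z => forall y, D y -> f y = n -> z = y)) => n.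
  have [[y [Dy fy]]|ny] := pselect (exists y, D y /\ f y = n).
    exists y => z Dz fz; apply: f_inj; rewrite ?in_setE//.
    by rewrite fy fz.
  by exists x0 => y Dy fy; case: ny; exists y.
exists d => x e e0.
have [|y [By Dy]] := Ddense (ball x e)° _ (open_interior _).
  by exists x; exact: nbhsx_ballx.
have := interior_subset By; rewrite ballEmdist/= metric_sym => xy.
by exists (f y); rewrite (dP _ _ Dy erefl).
Qed.

(** The neighbourhood A of x contains a ball of radius 3 c / (k + 1) whose
    center belongs to the dense sequence d and is at distance less than
    c / (k + 1) from x. *)
Lemma small_ball (R : realType) (X : metricType R) (d : nat -> X) (x : X)
    (A : set X) (c : R) : 0 < c ->
  (forall x e, 0 < e -> exists n, mdist (d n) x < e) -> nbhs x A ->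
  exists n k, k.+1%:R * mdist (d n) x < c /\
    forall y, k.+1%:R * mdist (d n) y < 3 * c -> A y.
Proof.
move=> c0 dd /nbhs_ballP[e /= e0 eA].
pose k := Num.bound (4 * c / e).
have ke : 4 * c < k.+1%:R * e.
  rewrite -ltr_pdivrMr//; apply: lt_le_trans (archi_boundP _) _.
    by rewrite !mulr_ge0 ?invr_ge0 ?ltW.
  by rewrite ler_nat.
have [n dn] := dd x (c / k.+1%:R) (divr_gt0 c0 (ltr0Sn _ _)).
have dnc : k.+1%:R * mdist (d n) x < c by rewrite mulrC -ltr_pdivlMr ?ltr0n.
exists n, k; split=> // y dny; apply: eA; rewrite ballEmdist/=.
have := metric_triangle x (d n) y; rewrite [mdist x (d n)]metric_sym.
rewrite -(@ltr_pM2l _ k.+1%:R) ?ltr0n// => xy.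
apply: le_lt_trans ke; apply: le_trans (ler_wpM2l (ler0n _ _) xy) _.
by rewrite mulrDr; lra.
Qed.

Theorem theorem2 (R : realType) (X : metricType R) (m : nat)
    (X_nonempty : [set: X] !=set0) (X_separable : separable_space X)
    (X_dim : covering_dim_eq X m) :
  exists S : nat -> bool -> set X,
    [/\ dyadic_subbase S, proper_subbase S & deg R S = m%:R%:E].
Proof.
have [dim_le dim_gt] := X_dim.
have unst := dim_lt_unstable_zeros dim_le.
(* A map to R^m all of whose perturbations by e have a zero. *)
have [f [e [fc e0 fzero]]] : exists (f : 'I_m -> X -> R) e,
    [/\ forall i, continuous (f i), 0 < e &
      forall g : 'I_m -> X -> R, (forall i, continuous (g i)) ->
        (forall i x, `|g i x - f i x| <= e) -> exists x, forall i, g i x = 0].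
  apply: contrapT => H; apply/dim_gt/unstable_zeros_dim_lt => f e fc e0.
  apply: contrapT => no; apply: H; exists f, e; split => // g gc gf.
  apply: contrapT => nox; apply: no; exists g; split=> // x.
  apply: contrapT => noi; apply: nox; exists x => i.
  by apply/eqP/negPn/negP => ?; apply: noi; exists i.
have [d dd] := separable_dense_seq X_nonempty X_separable.
(* The first m functions are those of f, rescaled so that perturbations by 1 / 2
   correspond to perturbations of f by e. The sets where the others are negative
   form a base of the topology, and still do after perturbations by 1 / 2. *)
pose h (n : nat) (x : X) : R := if insub n is Some i then f i x / (2 * e)
  else if choice.unpickle (n - m)%N is Some (p, k) then k.+1%:R * mdist (d p) x - 1
  else 0.
have hc : continuous_seq h.
  move=> n; rewrite /h; case: insub => [i|].
    by apply: continuous_fct_mul => //; exact: continuous_fct_cst.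
  case: choice.unpickle => [[p k]|]; last exact: continuous_fct_cst.
  apply: continuous_fct_sub; last exact: continuous_fct_cst.
  apply: continuous_fct_mul; first exact: continuous_fct_cst.
  exact: continuous_mdist.
pose B (pk : nat * nat) : set X := [set x | pk.2.+1%:R * mdist (d pk.1) x < 1].
pose P (i : m.+1.-tuple nat + (seq (option bool) * (nat * nat))) (g : nat -> X -> R) :=
  match i with
  | inl t => uniq t -> forall x : X, exists i, g (tnth t i) x != 0
  | inr (s, pk) => crossing (nth None s) (B pk) g
  end.
have dP i : stably_dense (@P i).
  case: i => [t|[s pk]]; last exact: stably_dense_crossing.
  apply: stably_dense_imp => t_uniq.
  exact: (@stably_dense_no_coincidence _ _ _ None t unst t_uniq isT).
have half0 : 0 < 2^-1 :> R by rewrite invr_gt0.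
have [g [gc hg gP]] := stably_dense_countable dP hc half0.
have gX : crossing_zeros g.
  move=> s A x s_fin xA gx.
  have [l sl] := (finite_seqP (tdom s)).1 s_fin.
  pose N := (\max_(i <- l) i).+1.
  have sN n : nth None (mkseq s N) n = s n.
    have [nN|Nn] := ltnP n N; first by rewrite nth_mkseq.
    rewrite nth_default ?size_mkseq//; apply/esym/eqP; apply: contraLR Nn => sn.
    rewrite -ltnNge ltnS; apply: leq_bigmax_seq => //.
    by have : tdom s n by []; rewrite sl.
  have [p [k [px pA]]] := small_ball ltr01 dd xA.
  have := gP (inr (mkseq s N, (p, k))); rewrite /P /crossing.
  move=> [[y By ys]|/(_ x px)[n]]; last by rewrite sN => /gx ->; rewrite eqxx.
  exists y; last by move=> n b sn; apply: ys; rewrite sN.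
  by apply: pA; apply: lt_trans By _; lra.
exists (sign_sets g); split.
- split.
  + apply: subbase_sign_sets => // x A xA.
    have [p [k [px pA]]] := small_ball half0 dd xA.
    pose n := (m + choice.pickle (p, k))%N.
    have hn y : h n y = k.+1%:R * mdist (d p) y - 1.
      by rewrite /h insubF ?addKn ?choice.pickleK// ltnNge leq_addr.
    exists n; rewrite /sign_sets /signed /=.
      by have := hg n x; rewrite hn ler_norml => /andP[? ?]; lra.
    move=> y /= gy; apply: pA.
    by have := hg n y; rewrite hn ler_norml => /andP[? ?]; lra.
  + by move=> n b; exact: regopen_sign_sets.
  + exact: exterior_sign_sets.
- exact: proper_sign_sets.
have zeroE x n : (~` (sign_sets g n false `|` sign_sets g n true)) x <-> g n x = 0.
  rewrite /sign_sets /signed/= oppr_gt0; split=> [gn|->]; last by rewrite ltxx => -[].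
  by apply/eqP; case: ltgtP gn => // gn; case; [left|right].
apply/eqP; rewrite eq_le; apply/andP; split.
  apply: ge_ereal_sup => _ [x _ <-]; apply: counting_le => D Dx.
  rewrite leqNgt; apply/negP => mD.
  have size_t : size (take m.+1 D) == m.+1 by rewrite size_takel.
  have := gP (inl (Tuple size_t)) (take_uniq _ (fset_uniq D)) x.
  move=> [i] /eqP; apply; apply/zeroE/Dx.
  exact: mem_take (mem_tnth i (Tuple size_t)).
have [||x gx] := fzero (fun i x => 2 * e * g i x).
- by move=> i; apply: continuous_fct_mul => //; exact: continuous_fct_cst.
- move=> i x; have := hg i x; rewrite /h valK => hgi.
  have -> : 2 * e * g i x - f i x = 2 * e * - (f i x / (2 * e) - g i x).
    by field; rewrite gt_eqF.
  rewrite normrM normrN (gtr0_norm (mulr_gt0 _ e0))//.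
  apply: (@le_trans _ _ (2 * e * 2^-1)); last by rewrite mulrAC divff// mul1r.
  by rewrite ler_wpM2l// mulr_ge0// ltW.
apply: (@le_trans _ _ (deg_at R (sign_sets g) x)); last first.
  by apply: ereal_sup_ubound; exists x.
apply: counting_ge => n nm; apply/zeroE.
have /eqP := gx (Ordinal nm); rewrite !mulf_eq0 pnatr_eq0 (gt_eqF e0)/=.
by move/eqP.
Qed.
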